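(* Fix $k\ge1$. Suppose that $(t_{k,n})_{n\ge1}$ is a sequence of finite rooted trees which converges locally to a tree $t_k$, and that $t_k$ has only finitely many ends. Then there exists a probability distribution $P_k[t_k]$ on the set of $k$-variable Boolean functions (depending only on $k$ and the limit tree $t_k$) such that for every $k$-variable Boolean function $f$ one has, as $n\to\infty$, $$P_k[t_{k,n}](f)\to P_k[t_k](f).$$
   Context: All trees are rooted and contain no node having exactly one child. A $k$-variable Boolean function is a map $\{\mathrm{False},\mathrm{True}\}^k\to\{\mathrm{False},\mathrm{True}\}$. A $k$-variable and/or tree is a finite rooted tree whose internal nodes are labelled by $\land$ or $\lor$ and whose leaves are labelled by literals in $\{x_1,\bar x_1,\dots,x_k,\bar x_k\}$; evaluating it from the leaves to the root gives the Boolean function $\mathrm{f}[\tau]$ represented by the and/or tree $\tau$. For a finite tree $t$, its randomly $k$-labelled version $\hat t$ is obtained by giving, independently, each internal node a uniform label in $\{\land,\lor\}$ and each leaf a uniform label in $\{x_1,\bar x_1,\dots,x_k,\bar x_k\}$. For a finite tree $t$ and a Boolean function $g$, $P_k[t](g)$ is the probability that $\mathrm{f}[\hat t]=g$. For a rooted tree $t$ and $h\ge0$, $t^h$ is the subtree induced on the nodes at distance at most $h$ from the root. A sequence $(t_n)_{n\ge1}$ converges locally to a tree $t$ (finite or infinite) if for every $h\ge 1$ there is $n_h$ such that for all $n\ge n_h$ the truncations $t_n^h$ and $t^h$ are isomorphic. The number of ends of a tree is the number of disjoint paths to infinity, i.e. the number of equivalence classes of infinite simple paths, where two paths are equivalent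 if their symmetric difference is finite. *)

(* Defs.v *)
From HB Require Import structures.
From mathcomp Require Import all_boot all_order all_algebra.
From mathcomp Require Import all_classical all_reals all_analysis.

Set Implicit Arguments.
Unset Strict Implicit.
Unset Printing Implicit Defensive.

Import Order.TTheory GRing.Theory Num.Theory.
Import numFieldNormedType.Exports.

Local Open Scope ring_scope.
Local Open Scope classical_set_scope.

(* A rooted tree with node set V is given by its parent function, with the
   convention that the root is its own parent (and is the only such node, by
   [rooted]). *)
Definition is_child (V : eqType) (r : V) (p : V -> V) : rel V :=
  fun x y => (y != r) && (p y == x).

Record rtree (V : eqType) := RTree {
  root : V;
  parent : V -> V;
  parent_root : parent root = root;
  rooted : forall x, exists n, iter n parent x = root;
  no_single_child : forall x y, is_child root parent x y ->
    exists2 z, is_child root parent x z & z != y }.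

Definition child (V : eqType) (t : rtree V) : rel V :=
  is_child (root t) (parent t).

(* Since the root is its own parent, this says that the distance of x to the
   root is at most h. *)
Definition within (V : eqType) (t : rtree V) (h : nat) (x : V) : bool :=
  iter h (parent t) x == root t.

Section Truncation.
Variables (V : eqType) (t : rtree V) (h : nat).

Definition trunc_node := {x : V | within t h x}.

Lemma within_root : within t h (root t).
Proof. by rewrite /within; elim: h => //= n /eqP ->; rewrite parent_root. Qed.

Lemma within_parent x : within t h x -> within t h (parent t x).
Proof. by rewrite /within -iterSr iterS => /eqP ->; rewrite parent_root. Qed.

Definition trunc_root : trunc_node := Sub (root t) within_root.
Definition trunc_parent (x : trunc_node) : trunc_node :=
  Sub (parent t (val x)) (within_parent (valP x)).

Lemma val_trunc_iter n x : val (iter n trunc_parent x) = iter n (parent t) (val x).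
Proof. by elim: n => //= n ->. Qed.

Fact trunc_parent_root : trunc_parent trunc_root = trunc_root.
Proof. by apply/val_inj; rewrite /= parent_root. Qed.

Fact trunc_rooted x : exists n, iter n trunc_parent x = trunc_root.
Proof. by exists h; apply/val_inj; rewrite val_trunc_iter; apply/eqP/(valP x). Qed.

Fact trunc_no_single_child x y : is_child trunc_root trunc_parent x y ->
  exists2 z, is_child trunc_root trunc_parent x z & z != y.
Proof.
case/andP=> yr /eqP yx.
have yr' : val y != root t by apply: contra yr => /eqP E; apply/eqP/val_inj.
have [z /andP[zr /eqP zx] zy] : exists2 z, child t (val x) z & z != val y.
  by apply: no_single_child; rewrite /is_child yr' -yx /=.
have sib n u : within t n u -> u != root t -> parent t u = parent t z ->
    within t n z.
  by rewrite /within; case: n => [/= -> //|n]; rewrite !iterSr => + _ <-.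
have zh : within t h z by apply: (sib _ _ (valP y)) => //; rewrite zx -yx.
exists (Sub z zh); last by apply: contra zy => /eqP <-.
apply/andP; split; first by apply: contra zr => /eqP/(congr1 val) /= ->.
by apply/eqP/val_inj.
Qed.

Definition truncate : rtree trunc_node :=
  RTree trunc_parent_root trunc_rooted trunc_no_single_child.
End Truncation.

Definition tree_iso (V W : eqType) (t : rtree V) (u : rtree W) : Prop :=
  exists phi : V -> W, [/\ bijective phi, phi (root t) = root u &
    forall x, phi (parent t x) = parent u (phi x)].

Definition converges_locally (V : nat -> finType) (tn : forall n, rtree (V n))
    (T : eqType) (t : rtree T) : Prop :=
  forall h, (1 <= h)%N -> exists nh, forall n, (nh <= n)%N ->
    tree_iso (truncate (tn n) h) (truncate t h).

Definition simple_path (V : eqType) (t : rtree V) (p : nat -> V) : Prop :=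
  injective p /\ forall i, child t (p i) (p i.+1) || child t (p i.+1) (p i).

Definition same_end (V : eqType) (p q : nat -> V) : Prop :=
  finite_set (range p `+` range q).

Definition ends (V : eqType) (t : rtree V) : set (set (nat -> V)) :=
  [set [set q | simple_path t q /\ same_end p q] | p in simple_path t].

Definition boolfun (k : nat) := {ffun {ffun 'I_k -> bool} -> bool}.

(* inl true is the connective "and", inl false is "or"; inr (i, true) is the
   literal x_i and inr (i, false) is its negation. *)
Definition label (k : nat) := (bool + 'I_k * bool)%type.

Section AndOrTrees.
Variables (V : finType) (t : rtree V) (k : nat).

Definition leaf (x : V) : bool := [forall y, ~~ child t x y].

(* The first argument bounds the recursion depth; #|V| is more than the height
   of t, see [node_valueE]. *)
Fixpoint eval_upto (n : nat) (l : V -> label k) (a : 'I_k -> bool) (x : V) : bool :=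
  if n is m.+1 then
    match l x with
    | inl true => [forall (y | child t x y), eval_upto m l a y]
    | inl false => [exists (y | child t x y), eval_upto m l a y]
    | inr (i, b) => a i == b
    end
  else false.

Definition node_value := eval_upto #|V|.

Definition represented (l : V -> label k) : boolfun k :=
  [ffun a : {ffun 'I_k -> bool} => node_value l a (root t)].

Lemma node_valueE l a x : node_value l a x =
  match l x with
  | inl true => [forall (y | child t x y), node_value l a y]
  | inl false => [exists (y | child t x y), node_value l a y]
  | inr (i, b) => a i == b
  end.
Proof.
suff stable n y : ~~ [exists s : n.-tuple V, path (child t) y s] ->
    eval_upto n l a y = eval_upto n.+1 l a y.
  rewrite {1}/node_value stable //; apply/existsP => -[s].
  suff H z r : path (child t) z r -> uniq (z :: r).
    by move=> /H/card_uniqP /= E; have := max_card [in x :: s];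
      rewrite E size_tuple ltnn.
  pose d z := ex_minn (let: ex_intro n e := rooted t z in
    ex_intro (fun n => iter n (parent t) z == root t) n (introT eqP e)).
  have dS u v : child t u v -> (d u < d v)%N.
    rewrite /d => /andP[vr /eqP vu].
    case: ex_minnP => m _ mmin; case: ex_minnP => -[|n] /= nP _.
      by rewrite nP in vr.
    by apply: mmin; rewrite -vu -iterSr.
  move=> zr; apply: (@map_uniq _ _ d).
  apply: (@sorted_uniq _ ltn ltn_trans ltnn) => /=; rewrite path_map.
  exact: sub_path zr.
elim: n y => [|n IH] y nopath.
  by case/negP: nopath; apply/existsP; exists [tuple].
have {}IH z : child t y z -> eval_upto n l a z = eval_upto n.+1 l a z.
  move=> yz; apply: IH; apply: contra nopath => /existsP[s zs].
  by apply/existsP; exists [tuple of z :: s]; rewrite /= yz.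
rewrite /= -/(eval_upto n.+1); case: (l y) => // -[].
  by apply: eq_forallb => z; case yz: (child t y z) => //=; apply: IH.
by apply: eq_existsb => z; case yz: (child t y z) => //=; apply: IH.
Qed.

Variable R : realType.

(* Law of the random label of x; the labels of distinct nodes are
   independent, so that their joint law is the product of these. *)
Definition label_law (x : V) (c : label k) : R :=
  match c with
  | inl _ => if leaf x then 0 else 2^-1
  | inr _ => if leaf x then (2 * k%:R)^-1 else 0
  end.

Definition tree_law (g : boolfun k) : R :=
  \sum_(l : {ffun V -> label k} | represented l == g) \prod_x label_law x (l x).

End AndOrTrees.

Arguments tree_law {V} t {k} R g.

Definition is_distribution (R : realType) (A : finType) (P : A -> R) : Prop :=
  (forall a, 0 <= P a) /\ \sum_a P a = 1.

(* Main.v *)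
(* Write v_x(a) for the value of the node x of a randomly labelled finite tree at
   the assignment a, and M_x(S) for the expectation of the product of the v_x(a),
   a in S.  Exchanging the two connectives and negating the literals shows that
   1 - v_x has the same law as v_x; hence M_x({a}) = 1/2, so M_x(S) <= 1/2 when S
   is nonempty, and, by independence of the subtrees and inclusion-exclusion, at
   every internal node x
     M_x(S) = 1/2 (prod_y M_y(S) + sum_(J <= S) (-1)^|J| prod_y M_y(J)),
   y ranging over the children of x.  As x has at least two children, the gap
   D_x(S) between the moments of corresponding nodes of two trees satisfies
     D_x(S) <= 1/2 sum_y D_y(S) + 1/4 sum_(J < S) sum_y D_y(J).
   So if the two trees agree up to height H, the gap at the root is of order
   (3/4)^h N, where N is the number of nodes of height h <= H having a descendant
   of height H (the other nodes of height h have gap zero).  For a locally finite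
   limit tree with finitely many ends, Koenig's lemma bounds N uniformly in h once
   H is large enough.  The law of the represented function is a linear
   combination of the moments at the root, so it is Cauchy along the sequence and
   its limit depends only on the limit tree. *)
Require Import Defs.
From mathcomp Require Import all_boot all_order all_algebra.
From mathcomp Require Import all_classical all_reals all_analysis.
From mathcomp Require Import ring lra zify.

Set Implicit Arguments.
Unset Strict Implicit.
Unset Printing Implicit Defensive.

Import Order.TTheory GRing.Theory Num.Theory.
Import numFieldNormedType.Exports.
Local Open Scope ring_scope.

(** * Product laws on labellings *)

Lemma prod_subr_expand (R : comNzRingType) (I : finType) (S : {set I}) (u : I -> R) :
  \prod_(i in S) (1 - u i) =
  \sum_(J : {set I} | J \subset S) (-1) ^+ #|J| * \prod_(i in J) u i.
Proof.
rewrite big_mkcond /=.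
(* Indices outside [S] get the factor 0 + 1, so that distributivity runs over all of [I]; a choice
   [J] not inside [S] then picks a factor 0. *)
rewrite (eq_bigr (fun i => (if i \in S then - u i else 0) + 1)); last first.
  by move=> i _; case: ifP => _; rewrite ?add0r // addrC.
rewrite bigA_distr [RHS]big_mkcond /=; apply: eq_bigr => J _.
case: ifP => [JS | /negbT/fintype.subsetPn[i iJ iS]].
  rewrite -big_mkcond -prodrN; apply: eq_bigr => i iJ.
  by rewrite (fintype.subsetP JS).
by rewrite (bigD1 i) //= iJ (negbTE iS) mul0r.
Qed.

Section ProductLaw.
Variables (R : comNzRingType) (V L : finType) (mu : V -> L -> R).
Hypothesis mu1 : forall x, \sum_c mu x c = 1.

Definition expect (F : {ffun V -> L} -> R) : R :=
  \sum_(l : {ffun V -> L}) (\prod_x mu x (l x)) * F l.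

Lemma expect_sum (I : Type) (r : seq I) (P : pred I) (F : I -> {ffun V -> L} -> R) :
  expect (fun l => \sum_(i <- r | P i) F i l) = \sum_(i <- r | P i) expect (F i).
Proof.
by rewrite /expect exchange_big; apply: eq_bigr => l _; rewrite mulr_sumr.
Qed.

Lemma expectZ a F : expect (fun l => a * F l) = a * expect F.
Proof. by rewrite /expect mulr_sumr; apply: eq_bigr => l _; rewrite mulrCA. Qed.

Lemma expectD F G : expect (fun l => F l + G l) = expect F + expect G.
Proof. by rewrite /expect -big_split; apply: eq_bigr => l _; rewrite mulrDr. Qed.

Lemma expectB F G : expect (fun l => F l - G l) = expect F - expect G.
Proof. by rewrite /expect -sumrB; apply: eq_bigr => l _; rewrite mulrBr. Qed.

Lemma eq_expect F G : F =1 G -> expect F = expect G.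
Proof. by move=> FG; apply: eq_bigr => l _; rewrite FG. Qed.

Lemma expect_marginal x psi : expect (fun l => psi (l x)) = \sum_c mu x c * psi c.
Proof.
(* Padding with factors 1 off [x] lets the sum over labellings factor node by node. *)
transitivity (\prod_y \sum_c mu y c * (if y == x then psi c else 1)).
  rewrite bigA_distr_bigA; apply: eq_bigr => l _.
  by rewrite big_split /= -big_mkcond big_pred1_eq.
rewrite (bigD1 x) //= [X in _ * X]big1 ?mulr1 => [|y yx].
  by apply: eq_bigr => c _; rewrite eqxx.
by rewrite -[RHS](mu1 y); apply: eq_bigr => c _; rewrite (negbTE yx) mulr1.
Qed.

Lemma expect_cst a : expect (fun=> a) = a.
Proof.
by rewrite /expect -mulr_suml -(bigA_distr_bigA mu) big1 ?mul1r.
Qed.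

(** Finite form of measurability with respect to the labels of the nodes in [D]. *)
Definition depends_on (D : {pred V}) (F : {ffun V -> L} -> R) :=
  forall l l' : {ffun V -> L}, {in D, l =1 l'} -> F l = F l'.

Lemma depends_on_prod (I : Type) (r : seq I) (P : pred I) (D : {pred V})
    (F : I -> {ffun V -> L} -> R) :
  (forall i, P i -> depends_on D (F i)) ->
  depends_on D (fun l => \prod_(i <- r | P i) F i l).
Proof. by move=> FD l l' ll'; apply: eq_bigr => i Pi; apply: FD. Qed.

Lemma sub_depends_on (D D' : {pred V}) F :
  {subset D <= D'} -> depends_on D F -> depends_on D' F.
Proof. by move=> DD' FD l l' ll'; apply: FD => x /DD'/ll'. Qed.

(* Exchanging the labels outside [D] of two independent labellings preserves
   their joint law. *)
Lemma expect_indep (D : {pred V}) F G :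
  depends_on D F -> depends_on [predC D] G ->
  expect (fun l => F l * G l) = expect F * expect G.
Proof.
move=> FD GD.
pose mix (p : {ffun V -> L} * {ffun V -> L}) : {ffun V -> L} :=
  [ffun x => if x \in D then p.1 x else p.2 x].
pose swap p := (mix p, mix (p.2, p.1)).
have swapK : involutive swap.
  by case=> l l'; congr (_, _); apply/ffunP => x; rewrite ffunE /= !ffunE /=;
    case: (x \in D).
(* A factor 1, written as an expectation, supplies the second labelling on which [swap] acts. *)
rewrite -[LHS]mulr1 -[in LHS](expect_cst 1) /expect !big_distrlr /= !pair_big /=.
rewrite (reindex_inj (inv_inj swapK)) /=; apply: eq_bigr => -[l l'] _ /=.
have -> : F (mix (l, l')) = F l.
  by apply: FD => x xD; rewrite ffunE xD.
have -> : G (mix (l, l')) = G l'.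
  by apply: GD => x; rewrite inE ffunE => /negbTE ->.
have E : \prod_x mu x (mix (l, l') x) * \prod_x mu x (mix (l', l) x) =
          \prod_x mu x (l x) * \prod_x mu x (l' x).
  rewrite -!big_split; apply: eq_bigr => x _; rewrite !ffunE /=.
  by case: ifP => // _; rewrite mulrC.
by rewrite mulr1 mulrAC E mulrACA mulrA.
Qed.

(** Induction on the list: the head is independent of the product over the tail. [uniq] excludes a
    repeated index, which would not be independent of itself. *)
Lemma expect_prod_indep (I : eqType) (r : seq I) (P : pred I) (D : I -> {pred V})
    (F : I -> {ffun V -> L} -> R) : uniq r ->
  (forall i, P i -> depends_on (D i) (F i)) ->
  (forall i j x, P i -> P j -> x \in D i -> x \in D j -> i = j) ->
  expect (fun l => \prod_(i <- r | P i) F i l) = \prod_(i <- r | P i) expect (F i).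
Proof.
move=> + FD Ddisj; elim: r => [_|i r IHr /= /andP[ir /IHr{}IHr]].
  by rewrite big_nil -[RHS]expect_cst; apply: eq_expect => l; rewrite big_nil.
rewrite big_cons -IHr; case: ifP => Pi; last first.
  by apply: eq_expect => l; rewrite big_cons Pi.
under eq_expect do rewrite big_cons Pi.
apply: (@expect_indep (D i)); first exact: FD.
move=> l l' ll'; rewrite big_seq_cond [RHS]big_seq_cond.
apply: eq_bigr => j /andP[jr Pj].
apply: FD => // x xj; apply: ll'; rewrite inE; apply: contraNN ir => xi.
by rewrite (Ddisj i j x).
Qed.

End ProductLaw.

(** * Depth in rooted trees *)

Section Depth.
Variables (V : eqType) (t : rtree V).
Implicit Types x y z : V.

Lemma iter_parent_root n : iter n (parent t) (Defs.root t) = Defs.root t.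
Proof. by elim: n => //= n ->; apply: parent_root. Qed.

Fact depth_subproof x : exists n, iter n (parent t) x == Defs.root t.
Proof. by have [n <-] := rooted t x; exists n. Qed.

Definition depth x := ex_minn (depth_subproof x).

Lemma depth_leE x n : (depth x <= n)%N = Defs.within t n x.
Proof.
rewrite /depth /Defs.within; case: ex_minnP => m /eqP mx mmin.
apply/idP/idP => [mn|]; last exact: mmin.
by rewrite -(subnK mn) iterD mx iter_parent_root.
Qed.

Lemma depth_eq0 x : (depth x == 0%N) = (x == Defs.root t).
Proof. by rewrite -leqn0 depth_leE. Qed.

Lemma depth_root : depth (Defs.root t) = 0%N.
Proof. by apply/eqP; rewrite depth_eq0. Qed.

Lemma depth_parent x : depth (parent t x) = (depth x).-1.
Proof.
apply/eqP; rewrite eqn_leq; apply/andP; split; last first.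
  by rewrite -subn1 leq_subLR add1n depth_leE /Defs.within iterSr
    -[_ == _]depth_leE.
rewrite depth_leE; have := leqnn (depth x); rewrite {1}depth_leE.
case: (depth x) => [|n]; rewrite /Defs.within ?iterSr //= => /eqP ->.
by rewrite parent_root.
Qed.

Lemma depth_iter n x : depth (iter n (parent t) x) = (depth x - n)%N.
Proof.
by elim: n => [|n IHn]; rewrite ?subn0 //= depth_parent IHn subnS.
Qed.

Lemma childE x y : child t x y = (0 < depth y)%N && (parent t y == x).
Proof. by rewrite /child /is_child -depth_eq0 lt0n. Qed.

Lemma depth_child x y : child t x y -> depth y = (depth x).+1.
Proof. by rewrite childE => /andP[y0 /eqP <-]; rewrite depth_parent prednK. Qed.

Lemma child_iter x n : (0 < depth x - n)%N ->
  child t (iter n.+1 (parent t) x) (iter n (parent t) x).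
Proof. by move=> nx; rewrite childE depth_iter nx /=. Qed.

(** The node [y] lies in the subtree rooted at [x], with [y = x] allowed: climbing from [y] to the
    depth of [x] leads to [x]. *)
Definition below x y := (depth x <= depth y)%N &&
  (iter (depth y - depth x) (parent t) y == x).

Lemma below_refl x : below x x.
Proof. by rewrite /below leqnn subnn /=. Qed.

Lemma below_child x c y : child t x c -> below c y -> below x y.
Proof.
rewrite childE => /andP[c0 /eqP <-] /andP[cy /eqP yc].
rewrite /below depth_parent (leq_trans (leq_pred _) cy).
have -> : (depth y - (depth c).-1 = (depth y - depth c).+1)%N by lia.
by rewrite iterS yc /=.
Qed.

Lemma not_below_child x c : child t x c -> ~~ below c x.
Proof. by move=> xc; rewrite /below (depth_child xc) ltnn. Qed.

(** Both [c] and [d] are the ancestor of [y] one level below [x]. So subtrees of siblings are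
    disjoint, whence their independence. *)
Lemma below_child_inj x c d y :
  child t x c -> child t x d -> below c y -> below d y -> c = d.
Proof.
move=> xc xd /andP[_ /eqP <-] /andP[_ /eqP <-].
by rewrite (depth_child xc) (depth_child xd).
Qed.
End Depth.

(** * Induction from the leaves and node values in finite trees *)

Section FiniteTree.
Variables (V : finType) (t : rtree V).
Implicit Types x y z : V.

(** Depths are bounded by some [M], and [M - depth t x] decreases from a node to its children. *)
Lemma tree_ind (P : V -> Prop) :
  (forall x, (forall y, child t x y -> P y) -> P x) -> forall x, P x.
Proof.
move=> step x; pose M := (\max_y depth t y)%N.
have [n] := ubnP (M - depth t x); elim: n x => // n IHn x xn.
apply: step => y xy; apply: IHn.
have yM : (depth t y <= M)%N by exact: leq_bigmax.
by move: xn yM; rewrite (depth_child xy); lia.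
Qed.

Lemma nonleaf_two_children x : ~~ leaf t x ->
  exists y z, [/\ child t x y, child t x z & z != y].
Proof.
move=> /forallPn[y]; rewrite negbK => xy.
by have [z xz zy] := no_single_child xy; exists y, z.
Qed.

Section Values.
Variables (k : nat).
Implicit Types (l : {ffun V -> label k}) (a : {ffun 'I_k -> bool}).

Lemma node_value_eq_below l l' a x :
  {in below t x, l =1 l'} -> node_value t l a x = node_value t l' a x.
Proof.
elim/tree_ind: x => x IHx ll'; rewrite !node_valueE ll'; last exact: below_refl.
have IH y : child t x y -> node_value t l a y = node_value t l' a y.
  by move=> xy; apply: IHx => // z yz; apply: ll'; apply: below_child yz.
case: (l' x) => // -[].
  by apply: eq_forallb => y; case xy: (child t x y) => //=; rewrite IH.
by apply: eq_existsb => y; case xy: (child t x y) => //=; rewrite IH.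
Qed.

Definition flip_label (c : label k) : label k :=
  match c with inl b => inl (~~ b) | inr (i, b) => inr (i, ~~ b) end.

Definition flip_labels l : {ffun V -> label k} := [ffun x => flip_label (l x)].

Lemma flip_labelsK : involutive flip_labels.
Proof.
by move=> l; apply/ffunP => x; rewrite !ffunE; case: (l x) => [b|[i b]] /=;
  rewrite negbK.
Qed.

(** De Morgan's laws at the connectives, negation of the literals at the leaves. *)
Lemma node_value_flip l a x : node_value t (flip_labels l) a x = ~~ node_value t l a x.
Proof.
elim/tree_ind: x => x IHx; rewrite !node_valueE ffunE.
case: (l x) => [[]|[i b]] /=.
- rewrite negb_forall; apply: eq_existsb => y.
  by case xy: (child t x y) => //=; rewrite IHx.
- rewrite negb_exists; apply: eq_forallb => y.
  by case xy: (child t x y) => //=; rewrite IHx.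
- by case: (a i); case: b.
Qed.

End Values.
End FiniteTree.

(** * Moments of node values *)

Lemma natr_forall (R : comNzRingType) (I : finType) (P b : pred I) :
  [forall (i | P i), b i]%:R = \prod_(i | P i) (b i)%:R :> R.
Proof.
case: forallP => [b1 | /existsNP[i /negP]].
  by rewrite big1 // => i Pi; have := b1 i; rewrite Pi /= => ->.
rewrite negb_imply => /andP[Pi /negbTE bi].
by rewrite (bigD1 i) //= bi mul0r.
Qed.

Lemma natr_exists (R : comNzRingType) (I : finType) (P b : pred I) :
  [exists (i | P i), b i]%:R = 1 - \prod_(i | P i) (1 - (b i)%:R) :> R.
Proof.
case: existsP => [[i /andP[Pi bi]] | b0].
  by rewrite (bigD1 i) //= bi subrr mul0r subr0.
rewrite big1 ?subrr // => i Pi; case bi: (b i); last by rewrite subr0.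
by case: b0; exists i; rewrite Pi.
Qed.

Section Moments.
Variables (R : realType) (k : nat).
Hypothesis k_gt0 : (0 < k)%N.
Local Notation A := {ffun 'I_k -> bool}.

(** The moment of a uniform random literal, common to all leaves of all trees. *)
Definition leaf_moment (S : {set A}) : R :=
  \sum_(p : 'I_k * bool) (2 * k%:R)^-1 * \prod_(a in S) (a p.1 == p.2)%:R.

Section OneTree.
Variables (V : finType) (t : rtree V).
Local Notation law := (label_law (k := k) t R).
Local Notation value l a x := ((node_value t l a x)%:R : R).
Implicit Types (x y : V) (S : {set A}).

Definition moment x S := expect law (fun l => \prod_(a in S) value l a x).

Lemma label_law_ge0 x c : 0 <= law x c.
Proof.
by case: c => [b|p] /=; case: ifP => // _; rewrite invr_ge0 ?mulr_ge0.
Qed.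

Lemma label_law_sum1 x : \sum_c law x c = 1.
Proof.
rewrite big_sumType /= big_bool /= sumr_const card_prod card_ord card_bool.
case: ifP => _; last by rewrite mul0rn addr0; lra.
have k0 : k%:R != 0 :> R by rewrite pnatr_eq0 -lt0n.
by rewrite !add0r -[LHS]mulr_natl natrM; field.
Qed.

Lemma label_law_flip x c : law x (flip_label c) = law x c.
Proof. by case: c => [b|[i b]]. Qed.

Lemma labelling_weight_ge0 (l : {ffun V -> label k}) : 0 <= \prod_x law x (l x).
Proof. by apply: prodr_ge0 => x _; exact: label_law_ge0. Qed.

Lemma le_expect F G : (forall l, F l <= G l) -> expect law F <= expect law G.
Proof.
by move=> FG; apply: ler_sum => l _; rewrite ler_wpM2l ?labelling_weight_ge0.
Qed.

(** The flip is an involution of the labellings that preserves their weights. *)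
Lemma expect_flip F : expect law (fun l => F (flip_labels l)) = expect law F.
Proof.
rewrite [RHS](reindex_inj (inv_inj (@flip_labelsK V k))); apply: eq_bigr => l _.
by congr (_ * _); apply: eq_bigr => x _; rewrite ffunE label_law_flip.
Qed.

Lemma moment_flip x S :
  expect law (fun l => \prod_(a in S) (1 - value l a x)) = moment x S.
Proof.
rewrite -expect_flip; apply: eq_expect => l; apply: eq_bigr => a _.
by rewrite node_value_flip; case: node_value; rewrite ?subrr ?subr0.
Qed.

Lemma moment_leaf x S : leaf t x -> moment x S = leaf_moment S.
Proof.
move=> lx.
(* The default 0 on connectives is harmless: these have weight 0 at a leaf. *)
transitivity (expect law (fun l => \prod_(a in S)
    (if l x is inr (i, b) then (a i == b)%:R else 0))).
  apply: eq_bigr => l _; rewrite (bigD1 x) //= -!mulrA.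
  case E: (l x) => [c|[i b]] /=; first by rewrite lx !mul0r.
  congr (_ * (_ * _)); apply: eq_bigr => a _.
  by rewrite node_valueE E.
rewrite (expect_marginal label_law_sum1 x (fun c => \prod_(a in S)
    (if c is inr (i, b) then (a i == b)%:R else 0))).
rewrite big_sumType /= big1 ?add0r => [|b _]; last by rewrite lx mul0r.
by apply: eq_bigr => -[i b] _ /=; rewrite lx.
Qed.

Lemma moment_ge0 x S : 0 <= moment x S.
Proof.
rewrite -[0](expect_cst label_law_sum1); apply: le_expect => l.
exact: prodr_ge0.
Qed.

(** By the flip symmetry the mean m of a value satisfies m = 1 - m. *)
Lemma moment_set1 x a : moment x [set a] = 2^-1.
Proof.
have mE : moment x [set a] = expect law (fun l => value l a x).
  by apply: eq_expect => l; rewrite big_set1.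
have := moment_flip x [set a]; under eq_expect do rewrite big_set1.
by rewrite expectB (expect_cst label_law_sum1) -mE; lra.
Qed.

(** A product of values in [0, 1] is at most any one of its factors, whose mean is 1/2. *)
Lemma moment_le_half x S : S != finset.set0 -> moment x S <= 2^-1.
Proof.
case/set0Pn => a aS; rewrite -(moment_set1 x a); apply: le_expect => l.
rewrite big_set1 (bigD1 a) //= ler_piMr //.
by apply: prodr_ile1 => b _; rewrite ler0n lern1 leq_b1.
Qed.

Lemma moment0 x : moment x finset.set0 = 1.
Proof.
rewrite -[RHS](expect_cst label_law_sum1); apply: eq_expect => l.
by rewrite big_set0.
Qed.

Lemma depends_on_value x (f : A -> R -> R) S :
  depends_on (below t x) (fun l => \prod_(a in S) f a (value l a x)).
Proof.
move=> l l' ll'; apply: eq_bigr => a _.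
by rewrite (@node_value_eq_below _ _ _ l l').
Qed.

(** Conditioning on the label of [x], which is independent of the labels in the subtrees of its
    children, these being independent of each other. *)
Lemma moment_nonleaf x S : ~~ leaf t x ->
  moment x S = 2^-1 * (\prod_(y | child t x y) moment y S +
    \sum_(J : {set A} | J \subset S) (-1) ^+ #|J| * \prod_(y | child t x y) moment y J).
Proof.
move=> lx.
(* Treats both connectives at once: [f] is the identity for [and], and u -> 1 - u for [or]. By the
   flip symmetry both lead to the same moments. *)
have prodE c (J : {set A}) (f : R -> R) :
    (forall y, expect law (fun l => \prod_(a in J) f (value l a y)) = moment y J) ->
  expect law (fun l : {ffun V -> label k} => (l x == inl c)%:R *
    \prod_(y | child t x y) \prod_(a in J) f (value l a y)) =
  2^-1 * \prod_(y | child t x y) moment y J.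
  move=> fE.
  rewrite (expect_indep label_law_sum1 (D := pred1 x)).
  - congr (_ * _).
      rewrite (expect_marginal label_law_sum1 x (fun d => (d == inl c)%:R)).
      rewrite (bigD1 (inl c)) //= eqxx (negbTE lx) mulr1 big1 ?addr0 // => d /negbTE ->.
      by rewrite mulr0.
    rewrite (expect_prod_indep label_law_sum1 (D := below t)).
    + by apply: eq_bigr => y _.
    + exact: index_enum_uniq.
    + by move=> y _; exact: (@depends_on_value y (fun=> f) J).
    + by move=> y z w xy xz wy wz; apply: below_child_inj xy xz wy wz.
  - by move=> l l' ll'; rewrite ll' ?inE.
  - apply: depends_on_prod => y xy.
    apply: (sub_depends_on _ (@depends_on_value y (fun=> f) J)).
    move=> z yz; rewrite !inE; apply: contraTneq yz => ->.
    exact: not_below_child.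
(* Splits according to the label of [x], literals having weight 0 there; under [or],
   inclusion-exclusion expands the product of the 1 - prod_y (1 - v_y(a)). *)
transitivity (expect law (fun l =>
    (l x == inl true)%:R * (\prod_(y | child t x y) \prod_(a in S) value l a y) +
    \sum_(J : {set A} | J \subset S) (-1) ^+ #|J| *
     ((l x == inl false)%:R *
      \prod_(y | child t x y) \prod_(a in J) (1 - value l a y)))).
  apply: eq_bigr => l _.
  case E: (l x) => [b|p]; last by rewrite (bigD1 x) //= E /= (negbTE lx) !mul0r.
  congr (_ * _); under eq_bigr do rewrite node_valueE E.
  case: b {E} => /=.
    rewrite mulr1n mul1r [X in _ = _ + X]big1 ?addr0 => [|J _]; last first.
      by rewrite mulr0n mul0r mulr0.
    by under eq_bigr do rewrite natr_forall; rewrite exchange_big.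
  rewrite mulr0n mul0r add0r; under eq_bigr do rewrite natr_exists.
  rewrite prod_subr_expand; apply: eq_bigr => J _.
  by rewrite mulr1n mul1r exchange_big.
rewrite expectD (prodE _ _ (fun u => u)) // mulrDr; congr (_ + _).
rewrite expect_sum mulr_sumr; apply: eq_bigr => J _.
by rewrite expectZ (prodE _ _ (fun u => 1 - u)) 1?mulrCA // => y; exact: moment_flip.
Qed.

(** The indicator of representing [f] is the product of v(a) where [f] is true and of 1 - v(a) where
    it is false; the latter factors are expanded by inclusion-exclusion. *)
Lemma tree_law_moment (f : boolfun k) :
  tree_law t R f = \sum_(J : {set A} | J \subset [set a | ~~ f a])
    (-1) ^+ #|J| * moment (Defs.root t) (J :|: [set a | f a]).
Proof.
transitivity (expect law (fun l => (represented t l == f)%:R)).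
  rewrite /tree_law big_mkcond; apply: eq_bigr => l _.
  by case: eqP; rewrite ?mulr1 ?mulr0.
transitivity (expect law (fun l => \sum_(J : {set A} | J \subset [set a | ~~ f a])
   (-1) ^+ #|J| * \prod_(a in J :|: [set a | f a]) value l a (Defs.root t)));
  last first.
  by rewrite expect_sum; apply: eq_bigr => J _; rewrite expectZ.
apply: eq_expect => l; set r := Defs.root t.
transitivity (\prod_(a in [set a | ~~ f a]) (1 - value l a r) *
              \prod_(a in [set a | f a]) value l a r).
  case: eqP => [<-|Nf].
    by rewrite !big1 ?mulr1 // => a; rewrite inE ffunE; case: node_value => // _;
      rewrite subr0.
  (* An assignment at which the two functions differ contributes a factor 0. *)
  have [a fa] : exists a : A, node_value t l a r != f a.
    apply/existsP; apply: contra_notT Nf => /existsPn fE; apply/ffunP => a.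
    by rewrite ffunE; apply/eqP; have := fE a; rewrite negbK.
  case E: (f a) fa => fa.
    rewrite [X in _ * X](bigD1 a) ?inE //=; move: fa.
    by case: node_value => //; rewrite mul0r mulr0.
  rewrite [X in X * _](bigD1 a) ?inE ?E //=; move: fa.
  by case: node_value => //; rewrite subrr !mul0r.
rewrite prod_subr_expand mulr_suml; apply: eq_bigr => J JS.
rewrite -mulrA -bigU; last first.
  rewrite finset.disjoints_subset; apply: fintype.subset_trans JS _.
  by apply/fintype.subsetP => a; rewrite !inE.
by congr (_ * _); apply: eq_bigl => a; rewrite !inE.
Qed.

End OneTree.
End Moments.

(** * Trees that agree up to a given height *)

Lemma tree_iso_sym (V W : eqType) (t : rtree V) (u : rtree W) :
  tree_iso t u -> tree_iso u t.
Proof.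
case=> phi [[psi phiK psiK] phi_root phi_parent]; exists psi; split.
- by exists phi.
- by rewrite -phi_root phiK.
- by move=> y; rewrite -{1}[y]psiK -phi_parent phiK.
Qed.

Lemma tree_iso_trans (V W X : eqType) (t : rtree V) (u : rtree W) (v : rtree X) :
  tree_iso t u -> tree_iso u v -> tree_iso t v.
Proof.
case=> phi [phi_bij phi_root phi_parent] [psi [psi_bij psi_root psi_parent]].
exists (psi \o phi); split; first exact: bij_comp.
- by rewrite /= phi_root.
- by move=> x /=; rewrite phi_parent psi_parent.
Qed.

(** An isomorphism of truncations as a pair of total maps, arbitrary beyond depth [H]; this avoids
    working in subtypes. *)
Definition iso_upto (V W : eqType) (H : nat) (t : rtree V) (u : rtree W)
    (f : V -> W) (g : W -> V) : Prop :=
  [/\ f (Defs.root t) = Defs.root u,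
      forall x, (depth t x <= H)%N -> f (parent t x) = parent u (f x),
      forall x, (depth t x <= H)%N -> depth u (f x) = depth t x /\ g (f x) = x &
      forall y, (depth u y <= H)%N -> depth t (g y) = depth u y /\ f (g y) = y].

Lemma tree_iso_upto (V W : eqType) (H : nat) (t : rtree V) (u : rtree W) :
  tree_iso (truncate t H) (truncate u H) -> exists f g, iso_upto H t u f g.
Proof.
case=> phi [[psi phiK psiK] phi_root phi_parent].
(* Nodes deeper than [H] are sent to the root by default. *)
pose f x := if insub x is Some x' then val (phi x') else Defs.root u.
pose g y := if insub y is Some y' then val (psi y') else Defs.root t.
have fE (x : trunc_node t H) : f (val x) = val (phi x) by rewrite /f valK.
have gE (y : trunc_node u H) : g (val y) = val (psi y) by rewrite /g valK.
have valE x : (depth t x <= H)%N -> exists x' : trunc_node t H, x = val x'.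
  by rewrite depth_leE => xH; exists (Sub x xH); rewrite SubK.
have valE' y : (depth u y <= H)%N -> exists y' : trunc_node u H, y = val y'.
  by rewrite depth_leE => yH; exists (Sub y yH); rewrite SubK.
have fR : f (Defs.root t) = Defs.root u.
  by rewrite -[Defs.root t]/(val (trunc_root t H)) fE phi_root.
have fP x : (depth t x <= H)%N -> f (parent t x) = parent u (f x).
  move=> /valE[x' ->]; rewrite -[parent t _]/(val (trunc_parent x')) !fE.
  by rewrite phi_parent.
have gf x : (depth t x <= H)%N -> g (f x) = x.
  by move=> /valE[x' ->]; rewrite fE gE phiK.
have fg y : (depth u y <= H)%N -> f (g y) = y.
  by move=> /valE'[y' ->]; rewrite gE fE psiK.
have fiter n x : (depth t x <= H)%N ->
    f (iter n (parent t) x) = iter n (parent u) (f x).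
  move=> xH; elim: n => //= n <-; rewrite fP // depth_iter.
  exact: leq_trans (leq_subr _ _) xH.
have fH x : (depth t x <= H)%N -> (depth u (f x) <= H)%N.
  by move=> /valE[x' ->]; rewrite fE depth_leE; apply: valP.
(* As [f] commutes with climbing and is injective up to depth [H], [x] and [f x] reach their roots
   after the same number of steps. *)
have fd x : (depth t x <= H)%N -> depth u (f x) = depth t x.
  move=> xH; apply/eqP; rewrite eqn_leq !depth_leE /Defs.within -fiter //.
  have := leqnn (depth t x); rewrite {1}depth_leE => /eqP ->; rewrite fR eqxx /=.
  have := leqnn (depth u (f x)); rewrite {1}depth_leE /Defs.within -fiter // -fR.
  move=> /eqP/(congr1 g); rewrite !gf ?depth_root //; first by move=> ->.
  by rewrite depth_iter (leq_trans (leq_subr _ _)).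
exists f, g; split=> // [x xH|y yH]; first by rewrite fd ?gf.
rewrite fg // -[in RHS](fg y) // fd //.
by have /valE'[y' ->] := yH; rewrite gE depth_leE; apply: valP.
Qed.

Lemma iso_upto_child (V W : eqType) (H : nat) (t : rtree V) (u : rtree W) f g x c :
  iso_upto H t u f g -> (depth t x <= H)%N -> (depth t c <= H)%N ->
  child u (f x) (f c) = child t x c.
Proof.
move=> [_ fP ff gg] xH cH; rewrite !childE (ff c cH).1 -fP //; congr (_ && _).
have pH : (depth t (parent t c) <= H)%N.
  by rewrite depth_parent (leq_trans (leq_pred _)).
apply/eqP/eqP => [/(congr1 g)|->//].
by rewrite (ff _ xH).2 (ff _ pH).2.
Qed.

(** Telescoping: each term has one difference and [size r - 1] other factors, all at most 1/2. *)
Lemma prod_sub_le_half_pow (R : realFieldType) (I : Type) (r : seq I) (F G : I -> R) :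
  (forall i, 0 <= F i <= 2^-1) -> (forall i, 0 <= G i <= 2^-1) ->
  `|\prod_(i <- r) F i - \prod_(i <- r) G i| <=
    2 * 2^-1 ^+ size r * \sum_(i <- r) `|F i - G i|.
Proof.
move=> F01 G01; elim: r => [|i r IHr]; first by rewrite !big_nil subrr normr0 mulr0.
rewrite !big_cons.
have -> : F i * \prod_(j <- r) F j - G i * \prod_(j <- r) G j =
  (F i - G i) * \prod_(j <- r) F j + G i * (\prod_(j <- r) F j - \prod_(j <- r) G j).
  by ring.
apply: (le_trans (ler_normD _ _)); rewrite !normrM.
have -> : 2 * 2^-1 ^+ size (i :: r) * (`|F i - G i| + \sum_(j <- r) `|F j - G j|) =
  `|F i - G i| * 2^-1 ^+ size r +
  2^-1 * (2 * 2^-1 ^+ size r * \sum_(j <- r) `|F j - G j|).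
  by rewrite /= exprS; field.
apply: lerD.
  rewrite ler_wpM2l // ger0_norm; last by apply: prodr_ge0 => j _; case/andP: (F01 j).
  elim: r {IHr} => [|j r IHr]; first by rewrite big_nil expr0.
  rewrite big_cons exprS; have /andP[F0 F1] := F01 j.
  apply: ler_pM => //; apply: prodr_ge0 => l _; by case/andP: (F01 l).
have /andP[G0 G1] := G01 i.
by apply: ler_pM => //; rewrite ger0_norm.
Qed.

(** Among nodes of depth at most [H], only at these can the moments of trees agreeing up to height
    [H] differ. *)
Definition deep (V : finType) (t : rtree V) (H : nat) (x : V) : bool :=
  [exists y, (depth t y == H) && below t x y].

Definition deep_count (V : finType) (t : rtree V) (h H : nat) : nat :=
  #|[pred x | (depth t x == h) && deep t H x]|.

Section Comparison.
Variables (R : realType) (k : nat).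
Hypothesis k_gt0 : (0 < k)%N.
Local Notation A := {ffun 'I_k -> bool}.
Variables (V W : finType) (t : rtree V) (u : rtree W) (H : nat).
Variables (f : V -> W) (g : W -> V).
Hypothesis tu : iso_upto H t u f g.
Implicit Types (x y : V) (S J : {set A}).
Local Notation mom S x := (moment R t x S).
Local Notation mom' S x := (moment R u (f x) S).
Local Notation gap S x := (`|mom S x - mom' S x|).

Lemma depth_child_le x c : (depth t x < H)%N -> child t x c -> (depth t c <= H)%N.
Proof. by move=> xH /depth_child ->. Qed.

Lemma big_child_iso (F : W -> R) x : (depth t x < H)%N ->
  \prod_(y | child u (f x) y) F y = \prod_(c | child t x c) F (f c).
Proof.
case: (tu) => _ fP ff gg xH; have xH' := ltnW xH.
rewrite (reindex_onto f g) => [|y /depth_child yx]; last first.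
  by apply: (gg y _).2; rewrite yx (ff x xH').1.
apply: eq_bigl => c; apply/andP/idP => [[xc /eqP gfc]|xc].
  have fcH : (depth u (f c) <= H)%N by rewrite (depth_child xc) (ff x xH').1.
  by rewrite -(iso_upto_child tu) // -gfc (gg _ fcH).1.
have cH := depth_child_le xH xc.
by rewrite (iso_upto_child tu) // (ff _ cH).2.
Qed.

(** The strict inequality puts the children within height [H], where [f] and [g] are mutually
    inverse. *)
Lemma leaf_iso x : (depth t x < H)%N -> leaf u (f x) = leaf t x.
Proof.
case: (tu) => _ fP ff gg xH; have xH' := ltnW xH.
apply/forallP/forallP => lx y.
  apply/negP => xy; have /negP := lx (f y); apply.
  by rewrite (iso_upto_child tu) // (depth_child_le xH xy).
apply/negP => xy; have yH : (depth u y <= H)%N.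
  by rewrite (depth_child xy) (ff x xH').1.
have /negP := lx (g y); apply.
by rewrite -(iso_upto_child tu) ?(gg y yH).1 // (gg y yH).2.
Qed.

Lemma deep_child x c : child t x c -> deep t H c -> deep t H x.
Proof.
move=> xc /existsP[y /andP[yH cy]]; apply/existsP; exists y.
by rewrite yH (below_child xc cy).
Qed.

(** The whole subtree of [x] stays above height [H], so the recursion for moments runs identically
    in both trees. *)
Lemma moment_eq_not_deep x S : (depth t x <= H)%N -> ~~ deep t H x ->
  mom S x = mom' S x.
Proof.
elim/(tree_ind (t := t)): x S => x IHx S xH xdeep.
have {}xH : (depth t x < H)%N.
  rewrite ltn_neqAle xH andbT; apply: contraNneq xdeep => xH'.
  by apply/existsP; exists x; rewrite xH' eqxx below_refl.
have IH J : \prod_(y | child t x y) mom J y = \prod_(y | child t x y) mom' J y.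
  apply: eq_bigr => y xy; apply: IHx => //; first exact: depth_child_le xy.
  by apply: contra xdeep; apply: deep_child.
have [lx|lx] := boolP (leaf t x).
  by rewrite !moment_leaf ?leaf_iso.
rewrite !moment_nonleaf ?leaf_iso // IH big_child_iso //; congr (_ * (_ + _)).
by apply: eq_bigr => J _; rewrite IH big_child_iso.
Qed.

(* Every child has a sibling, whose moments are at most 1/2: hence the factors
   1/2 and 1/4. *)
Lemma gap_rec x S : (depth t x < H)%N ->
  gap S x <= 2^-1 * \sum_(c | child t x c) gap S c +
             4^-1 * \sum_(J : {set A} | J \proper S) \sum_(c | child t x c) gap J c.
Proof.
move=> xH; have [lx|lx] := boolP (leaf t x).
  rewrite !moment_leaf ?leaf_iso // subrr normr0.
  by apply: addr_ge0; apply: mulr_ge0; rewrite // ?sumr_ge0 // => J _;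
    rewrite sumr_ge0.
pose d J := `|\prod_(c | child t x c) mom J c - \prod_(c | child t x c) mom' J c|.
have dle J : d J <= 2^-1 * \sum_(c | child t x c) gap J c.
  (* The empty moment is 1 and escapes the bound 1/2, but then both products equal 1. *)
  have [->|J0] := eqVneq J finset.set0.
    by rewrite /d !big1 => [|c _|c _|c _]; rewrite ?moment0 // ?subrr ?normr0 ?mulr0.
  rewrite /d -!(big_filter _ (child t x)).
  set r := [seq c <- _ | _].
  apply: (le_trans (prod_sub_le_half_pow r _ _)).
  - by move=> c; rewrite moment_ge0 ?moment_le_half.
  - by move=> c; rewrite moment_ge0 ?moment_le_half.
  apply: ler_wpM2r; first by apply: sumr_ge0 => *.
  have : (2 <= size r)%N.
    have [y [z [xy xz zy]]] := nonleaf_two_children lx.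
    apply: (@uniq_leq_size _ [:: y; z]); first by rewrite /= inE eq_sym zy.
    by move=> w; rewrite !inE mem_filter mem_index_enum andbT => /orP[]/eqP ->.
  case: (size r) => [|[|n]] // _; rewrite !exprS mulrA divff // mul1r.
  by rewrite ler_piMr // exprn_ile1 //; lra.
rewrite !(moment_nonleaf _ k_gt0) ?leaf_iso // !big_child_iso //.
under [X in _ - _ * (_ + X)]eq_bigr do rewrite big_child_iso //.
rewrite -mulrBr normrM ger0_norm // opprD addrACA -sumrB.
under [X in _ * `|_ + X|]eq_bigr do rewrite -mulrBr.
(* The second [d S] is the term [J = S] of the alternating sum. *)
apply: (@le_trans _ _ (2^-1 * (d S + (d S + \sum_(J : {set A} | J \proper S) d J)))).
  apply: ler_wpM2l => //; apply: (le_trans (ler_normD _ _)); apply: lerD => //.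
  apply: (le_trans (ler_norm_sum _ _ _)).
  rewrite (bigD1 S) //=; apply: lerD.
    by rewrite normrM normrX normrN1 expr1n mul1r.
  rewrite le_eqVlt; apply/orP; left; apply/eqP; apply: eq_big => J.
    by rewrite finset.properEneq andbC.
  by rewrite normrM normrX normrN1 expr1n mul1r.
have := dle S; have : \sum_(J : {set A} | J \proper S) d J <=
   2^-1 * \sum_(J : {set A} | J \proper S) \sum_(c | child t x c) gap J c.
  by rewrite mulr_sumr; apply: ler_sum => J _.
by lra.
Qed.

Definition level_gap n S := \sum_(x | depth t x == n) gap S x.

Lemma sum_level_children n (F : V -> R) :
  \sum_(x | depth t x == n) \sum_(c | child t x c) F c =
  \sum_(c | depth t c == n.+1) F c.
Proof.
rewrite [RHS](partition_big (parent t) (fun x => depth t x == n)) /=; last first.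
  by move=> c /eqP cn; rewrite depth_parent cn.
apply: eq_bigr => x /eqP xn; apply: eq_bigl => c; rewrite childE.
apply/andP/andP => -[c0 /eqP cx]; split; rewrite ?cx //.
  by rewrite -xn -cx depth_parent prednK.
by rewrite (eqP c0).
Qed.

Lemma level_gap_rec n S : (n < H)%N ->
  level_gap n S <= 2^-1 * level_gap n.+1 S +
                   4^-1 * \sum_(J : {set A} | J \proper S) level_gap n.+1 J.
Proof.
move=> nH; rewrite /level_gap -sum_level_children.
under [X in _ + _ * X]eq_bigr do rewrite -sum_level_children.
rewrite exchange_big /= !mulr_sumr -big_split; apply: ler_sum => x /eqP xn.
by apply: gap_rec; rewrite xn.
Qed.

Local Notation B := (#|{set A}|%:R : R).

(** The weight [B ^+ #|S|] absorbs the sum over proper subsets, so each level climbed costs a factor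
    1/2 + 1/4 = 3/4. At level [h] only deep nodes count, each with gap at most 1. *)
Lemma level_gap_le h m S : (m <= h)%N -> (h <= H)%N ->
  level_gap (h - m)%N S <=
  B ^+ #|S| * (3 / 4) ^+ m * (deep_count t h H)%:R.
Proof.
have lin (a b s : R) : s <= b -> a <= b -> 2^-1 * a + 4^-1 * s <= 3 / 4 * b by lra.
move=> + hH; set N := (deep_count t h H)%:R.
have B1 : 1 <= B by rewrite ler1n; apply/card_gt0P; exists finset.set0.
elim: m S => [S _|m IHm S mh].
  rewrite subn0 expr0 mulr1.
  apply: (@le_trans _ _ (\sum_(x | (depth t x == h) && deep t H x) 1)).
    rewrite big_mkcondr /=; apply: ler_sum => x /eqP xh.
    case: ifPn => [_|xdeep]; last by rewrite moment_eq_not_deep ?xh // subrr normr0.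
    have [-> | S0] := eqVneq S finset.set0.
      by rewrite !moment0 // subrr normr0.
    have := moment_le_half R k_gt0 t x S0; have := moment_le_half R k_gt0 u (f x) S0.
    have := moment_ge0 R k_gt0 t x S; have := moment_ge0 R k_gt0 u (f x) S.
    by move=> *; rewrite ler_norml; apply/andP; split; lra.
  rewrite sumr_const ler_peMl // exprn_ege1 //.
have hmE : (h - m = (h - m.+1).+1)%N by lia.
apply: (le_trans (level_gap_rec _ _)); first by lia.
rewrite -hmE; have IH J := IHm J (ltnW mh).
set q := (3 / 4) ^+ m in IH *.
have N0 : 0 <= q * N by rewrite mulr_ge0 // exprn_ge0 //; lra.
(* There are at most [B] sets [J], each of size at most [#|S| - 1]. *)
have sumB : \sum_(J : {set A} | J \proper S) B ^+ #|J| <= B ^+ #|S|.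
  apply: (@le_trans _ _ (\sum_(J : {set A} | J \proper S) B ^+ #|S|.-1)).
    apply: ler_sum => J /proper_card JS; apply: ler_weXn2l => //.
    by rewrite -ltnS (ltn_predK JS).
  have [->|] := eqVneq S finset.set0.
    rewrite big_pred0 ?exprn_ge0 // => J.
    by rewrite finset.properEneq finset.subset0 andNb.
  rewrite -card_gt0; case: #|S| => //= s _.
  rewrite sumr_const -[_ *+ _]mulr_natl exprS ler_wpM2r ?exprn_ge0 //.
  by rewrite ler_nat max_card.
have : \sum_(J : {set A} | J \proper S) level_gap (h - m)%N J <= B ^+ #|S| * (q * N).
  apply: (le_trans _ (ler_wpM2r N0 sumB)); rewrite mulr_suml.
  by apply: ler_sum => J _; rewrite mulrA.
have := IH S; rewrite [_ ^+ m.+1]exprS -/q !mulrA.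
have -> b : b * 3 / 4 * q * N = 3 / 4 * (b * q * N) by ring.
by move=> ? ?; exact: lin.
Qed.

(** Level 0, reached by climbing [h] levels, contains the root; the extra factor [B] bounds the
    number of sets [J] in the moment formula. *)
Lemma tree_law_gap h (F : boolfun k) : (h <= H)%N ->
  `|tree_law t R F - tree_law u R F| <=
  B ^+ #|A|.+1 * (3 / 4) ^+ h * (deep_count t h H)%:R.
Proof.
move=> hH; case: (tu) => fR _ _ _.
rewrite !tree_law_moment -sumrB; set N := (deep_count t h H)%:R.
have B1 : 1 <= B by rewrite ler1n; apply/card_gt0P; exists finset.set0.
have N0 : 0 <= (3 / 4) ^+ h * N by rewrite mulr_ge0 // exprn_ge0 //; lra.
apply: (le_trans (ler_norm_sum _ _ _)).
apply: (@le_trans _ _ (\sum_(J : {set A}) B ^+ #|A| * ((3 / 4) ^+ h * N))).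
  rewrite big_mkcond /=; apply: ler_sum => J _; case: ifP => _; last first.
    by rewrite mulr_ge0 // exprn_ge0.
  rewrite -mulrBr normrM normrX normrN1 expr1n mul1r -fR.
  set S := _ :|: _.
  have := level_gap_le S (leqnn h) hH; rewrite subnn /level_gap.
  rewrite (bigD1 (Defs.root t)) /= ?depth_root // => gapS.
  apply: (@le_trans _ _ (B ^+ #|S| * (3 / 4) ^+ h * N)).
    by apply: le_trans gapS; rewrite lerDl; apply: sumr_ge0 => *.
  by rewrite -mulrA ler_wpM2r // ler_weXn2l // max_card.
by rewrite sumr_const cardT -cardE -[_ *+ _]mulr_natl exprS !mulrA.
Qed.

End Comparison.

(** * Ends *)

Local Open Scope classical_set_scope.

Section Ends.
Variables (T : eqType) (t : rtree T).
Implicit Types x y c : T.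

Definition locally_finite :=
  forall n, exists s : seq T, forall y, (depth t y <= n)%N -> y \in s.

Definition alive x :=
  forall n, exists y, depth t y = (depth t x + n)%N /\ below t x y.

Lemma below_iter x y n :
  below t x y -> (depth t x + n <= depth t y)%N -> below t x (iter n (parent t) y).
Proof.
move=> /andP[xy /eqP yx] xny; rewrite /below depth_iter -iterD.
have -> : (depth t y - n - depth t x + n = depth t y - depth t x)%N by lia.
by rewrite yx eqxx andbT; lia.
Qed.

(** The quantifier on [m] precedes the hypothesis so that [choice] yields a function on all nodes.
    Climbing from a deeper descendant would give one at exactly the excluded depth. *)
Lemma not_alive_bound x :
  exists m, ~ alive x -> forall y, below t x y -> (depth t y < depth t x + m)%N.
Proof.
have [|/existsNP[m xm]] := pselect (alive x); first by exists 0%N.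
exists m => _ y xy; rewrite ltnNge; apply/negP => my; apply: xm.
exists (iter (depth t y - (depth t x + m)) (parent t) y); split.
  by rewrite depth_iter subKn.
by apply: below_iter => //; move: my; lia.
Qed.

Hypothesis t_lf : locally_finite.

Lemma deep_nodes_alive h : exists2 H, (h < H)%N & forall x y,
  depth t x = h -> depth t y = H -> below t x y -> alive x.
Proof.
have [m mP] := choice not_alive_bound.
have [s sP] := t_lf h.
(* Beyond the reach of every non-alive node at level [h]; the successor ensures [h < H]. *)
exists (h + (\max_(x <- s) m x).+1)%N => [|x y xh yH xy]; first by lia.
apply: contrapT => /mP/(_ y xy); rewrite xh yH.
have : (m x <= \max_(x <- s) m x)%N.
  by apply: leq_bigmax_seq => //; apply: sP; rewrite xh.
by lia.
Qed.

(** Koenig's lemma: if no child were alive, a common bound [M] on their heights would contradict a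
    descendant of [x] lying [M.+1] levels below it. *)
Lemma alive_child x : alive x -> exists c, child t x c /\ alive c.
Proof.
move=> x_alive; apply: contrapT => nochild.
have [m mP] := choice not_alive_bound.
have [s sP] := t_lf (depth t x).+1.
pose M := (\max_(c <- s) m c)%N.
have [y [yM /andP[_ /eqP yx]]] := x_alive M.+1.
have xc : child t x (iter M (parent t) y).
  rewrite -yx; have -> : (depth t y - depth t x = M.+1)%N by rewrite yM; lia.
  by apply: child_iter; rewrite yM; lia.
have cM := depth_child xc; set c := iter M _ y in xc cM.
have /mP/(_ y) : ~ alive c by move=> c_alive; apply: nochild; exists c.
rewrite cM yM /below cM yM.
have -> : (depth t x + M.+1 - (depth t x).+1 = M)%N by lia.
rewrite eqxx andbT => /(_ ltac:(lia)).
have : (m c <= M)%N by apply: leq_bigmax_seq => //; apply: sP; rewrite cM.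
by lia.
Qed.

Definition descending (p : nat -> T) := forall i, child t (p i) (p i.+1).

Lemma alive_descending x : exists p, alive x -> p 0%N = x /\ descending p.
Proof.
have next_ex z : exists c, alive z -> child t z c /\ alive c.
  by have [/alive_child[c]|] := pselect (alive z); [exists c|exists z].
have [next nextP] := choice next_ex.
exists (fun n => iter n next x) => x_alive; split=> // i.
suff : alive (iter i next x) by case/nextP.
by elim: i => //= i /nextP[].
Qed.

Lemma depth_descending p n : descending p -> depth t (p n) = (depth t (p 0%N) + n)%N.
Proof.
move=> dp; elim: n => [|n IHn]; first by rewrite addn0.
by rewrite (depth_child (dp n)) IHn addnS.
Qed.

Lemma descending_inj p : descending p -> injective p.
Proof.
move=> dp i j /(congr1 (depth t)).
by rewrite (depth_descending i dp) (depth_descending j dp) => /addnI.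
Qed.

Lemma iter_descending p n : descending p -> iter n (parent t) (p n) = p 0%N.
Proof.
move=> dp; elim: n => // n IHn; rewrite iterSr.
by have := dp n; rewrite childE => /andP[_ /eqP ->].
Qed.

Lemma descending_simple p : descending p -> simple_path t p.
Proof. by move=> dp; split=> [|i]; [exact: descending_inj|rewrite dp]. Qed.

(** A common node would give equal starting points by climbing. So rays with distinct starts at one
    depth are disjoint, and their symmetric difference contains the infinite range of [p]. *)
Lemma same_end_descending p q : descending p -> descending q ->
  depth t (p 0%N) = depth t (q 0%N) -> same_end p q -> p 0%N = q 0%N.
Proof.
move=> dp dq pq; apply: contraPP => p0q0 fin_pq.
have : finite_set (range p).
  apply: sub_finite_set fin_pq => _ [n _ <-]; left; split; first by exists n.
  move=> [m _ qm]; apply: p0q0.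
  have /(congr1 (depth t)) := qm.
  rewrite (depth_descending n dp) (depth_descending m dq) pq => /addnI mn.
  by rewrite -(iter_descending n dp) -qm mn iter_descending.
have p_inj : {in p @^-1` range p &, injective p}.
  by move=> i j _ _; exact: descending_inj.
by move=> /(finite_preimage p_inj); rewrite preimage_range; exact: infinite_nat.
Qed.

End Ends.

(** Rays from distinct alive nodes of one level lie in distinct ends, so [N] can be the number of
    ends, whatever the level. *)
Lemma alive_level_bound (T : eqType) (t : rtree T) :
  locally_finite t -> finite_set (ends t) ->
  exists N, forall h (s : seq T), uniq s ->
    (forall x, x \in s -> depth t x = h /\ alive t x) -> (size s <= N)%N.
Proof.
move=> t_lf /finite_setP[N]; rewrite card_eq_le => /andP[/pcard_leP[code] _].
have [ray rayP] := choice (alive_descending t_lf).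
pose e x := [set q | simple_path t q /\ same_end (ray x) q].
exists N => h s s_uniq sP.
have eE x : x \in s -> ends t (e x).
  move=> /sP[_ /rayP[_ dx]]; exists (ray x) => //; exact: descending_simple.
have e_inj : {in s &, injective e}.
  move=> x y /sP[xh /rayP[x0 dx]] /sP[yh /rayP[y0 dy]] exy.
  rewrite -x0 -y0; apply: (same_end_descending dx dy); first by rewrite x0 y0 xh yh.
  have : e y (ray y).
    split; first exact: descending_simple.
    by rewrite /same_end setYK; exact: finite_set0.
  by rewrite -exy => -[].
rewrite -(size_map (code \o e)) -[leqRHS](size_iota 0).
apply: uniq_leq_size.
  rewrite map_inj_in_uniq // => x y xs ys /=.
  have ex := eE x xs; have ey := eE y ys.
  by move=> /('inj_code (mem_set ex) (mem_set ey)); exact: e_inj.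
move=> _ /mapP[x xs ->]; rewrite mem_iota /=.
by have := @funS _ _ _ _ code _ (eE x xs).
Qed.

Lemma iso_upto_below (V W : eqType) (H : nat) (t : rtree V) (u : rtree W) f g x y :
  iso_upto H t u f g -> (depth t y <= H)%N -> below t x y -> below u (f x) (f y).
Proof.
move=> [_ fP ff _] yH /andP[xy /eqP yx].
have fiter n : f (iter n (parent t) y) = iter n (parent u) (f y).
  elim: n => //= n <-; rewrite fP // depth_iter.
  exact: leq_trans (leq_subr _ _) yH.
have xH := leq_trans xy yH.
by rewrite /below (ff x xH).1 (ff y yH).1 xy -fiter yx /=.
Qed.

(** For [H] large, [f] injects the deep nodes of [u] at level [h] into the alive nodes of [t] at
    that level. *)
Lemma deep_count_bound (T : eqType) (t : rtree T) :
  locally_finite t -> finite_set (ends t) ->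
  exists N, forall h, exists2 H, (h < H)%N &
    forall (V : finType) (u : rtree V) f g, iso_upto H u t f g ->
      (deep_count u h H <= N)%N.
Proof.
move=> t_lf t_ends; have [N NP] := alive_level_bound t_lf t_ends.
exists N => h; have [H hH HP] := deep_nodes_alive t_lf h.
exists H => // V u f g ut; have [_ _ ff _] := ut.
have DH x : x \in [pred x | (depth u x == h) && deep u H x] -> (depth u x <= H)%N.
  by move=> /andP[/eqP -> _]; exact: ltnW.
rewrite /deep_count cardE -(size_map f); apply: (NP h).
  rewrite map_inj_in_uniq ?enum_uniq // => x y.
  rewrite !mem_enum => /DH xH /DH yH /(congr1 g).
  by rewrite (ff _ xH).2 (ff _ yH).2.
move=> _ /mapP[x + ->]; rewrite mem_enum => xD; have xH := DH x xD.
move: xD => /andP[/eqP xh /existsP[y /andP[/eqP yH xy]]].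
have yH' : (depth u y <= H)%N by rewrite yH.
have fxh : depth t (f x) = h by rewrite (ff _ xH).1.
split=> //; apply: (HP _ (f y)) => //; first by rewrite (ff _ yH').1.
exact: iso_upto_below ut yH' xy.
Qed.

Lemma locally_finite_limit (V : nat -> finType) (tn : forall n, rtree (V n))
    (T : eqType) (t : rtree T) :
  converges_locally tn t -> locally_finite t.
Proof.
move=> tn_t n.
(* Height [n.+1] because convergence only speaks of positive heights. *)
have [m /(_ m (leqnn m))/tree_iso_upto[f [g [_ _ _ fg]]]] := tn_t n.+1 isT.
exists [seq f x | x : V m] => y yn; apply/mapP; exists (g y); first by rewrite mem_enum.
by rewrite (fg y (leqW yn)).2.
Qed.

(** * Convergence of the laws *)

Section Limit.
Variables (R : realType) (k : nat).
Hypothesis k_gt0 : (0 < k)%N.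

Lemma tree_law_distribution (V : finType) (t : rtree V) :
  is_distribution (fun f : boolfun k => tree_law t R f).
Proof.
split=> [f|].
  by apply: sumr_ge0 => l _; apply: prodr_ge0 => x _; apply: label_law_ge0.
rewrite -[RHS](expect_cst (label_law_sum1 R k_gt0 t) 1) /expect.
rewrite [RHS](partition_big (fun l : {ffun V -> label k} => represented t l) xpredT) //=.
by apply: eq_bigr => f _; apply: eq_bigr => l _; rewrite mulr1.
Qed.

Lemma tree_law_truncation_gap (T : eqType) (t : rtree T) (e : R) :
  locally_finite t -> finite_set (ends t) -> 0 < e ->
  exists2 H, (0 < H)%N & forall (V W : finType) (u : rtree V) (v : rtree W),
    tree_iso (truncate u H) (truncate t H) ->
    tree_iso (truncate v H) (truncate t H) ->
    forall f : boolfun k, `|tree_law u R f - tree_law v R f| < e.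
Proof.
move=> t_lf t_ends e0; have [N NP] := deep_count_bound t_lf t_ends.
pose A : finType := {ffun 'I_k -> bool}.
(* [N.+1] keeps [C] positive; as [N] is uniform in [h], [C] can be fixed before [h], and [H]
   follows. *)
pose C : R := #|{set A}|%:R ^+ #|A|.+1 * N.+1%:R.
have C0 : 0 < C.
  rewrite mulr_gt0 // exprn_gt0 // ltr0n; by apply/card_gt0P; exists finset.set0.
have [h hC] : exists h, (3 / 4) ^+ h < e / C.
  have /cvgrPdist_lt/(_ (e / C)) : (GRing.exp (3 / 4 : R)) @ \oo --> (0 : R).
    by apply: cvg_expr; rewrite ger0_norm; lra.
  rewrite divr_gt0 // => /(_ isT)[h _ hP]; exists h; have := hP h (leqnn h).
  by rewrite /= sub0r normrN ger0_norm // exprn_ge0 //; lra.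
have [H hH HP] := NP h; exists H; first by lia.
move=> V W u v ut vt f.
have [f1 [g1 ut']] := tree_iso_upto ut.
have [f2 [g2 uv]] := tree_iso_upto (tree_iso_trans ut (tree_iso_sym vt)).
apply: (le_lt_trans (tree_law_gap R k_gt0 uv f (ltnW hH))).
apply: (@le_lt_trans _ _ (C * (3 / 4) ^+ h)); last by rewrite mulrC -ltr_pdivlMr.
rewrite /C [leRHS]mulrAC ler_wpM2l //.
by rewrite ler_nat (leq_trans (HP _ _ _ _ ut')).
Qed.

End Limit.

Theorem theorem2p3 (R : realType) (k : nat) (k_ge1 : (1 <= k)%N)
    (T : eqType) (t : rtree T) (fin_ends : finite_set (ends t)) :
  exists P : boolfun k -> R, is_distribution P /\
    forall (V : nat -> finType) (tn : forall n, rtree (V n)),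
      converges_locally tn t ->
      forall f : boolfun k, tree_law (tn n) R f @[n --> \oo] --> P f.
Proof.
(* If no sequence converges to [t], any distribution will do; a point mass is taken. Otherwise [t0]
   is a reference sequence defining [P] before the given sequence is known. *)
have [[V0 [t0 t0_t]]|no_seq] :=
    pselect (exists V tn, @converges_locally V tn T t); last first.
  exists (fun f => (f == [ffun=> true])%:R); split.
    split=> [f|]; first exact: ler0n.
    by rewrite (bigD1 [ffun=> true]) //= eqxx big1 ?addr0 // => f /negbTE ->.
  by move=> V tn tn_t; case: no_seq; exists V, tn.
have gap := tree_law_truncation_gap k_ge1 (locally_finite_limit t0_t) fin_ends.
(* Used with [tn = t0] for the Cauchy property, then with an arbitrary sequence to identify its
   limit. *)
have gap_near (V : nat -> finType) (tn : forall n, rtree (V n)) :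
    converges_locally tn t -> forall e : R, 0 < e ->
    exists N, forall n m, (N <= n)%N -> (N <= m)%N ->
    forall f : boolfun k, `|tree_law (tn n) R f - tree_law (t0 m) R f| < e.
  move=> tn_t e /gap[H H0 HP].
  have [N1 N1P] := tn_t H H0; have [N2 N2P] := t0_t H H0.
  exists (maxn N1 N2) => n m; rewrite !geq_max => /andP[n1 _] /andP[_ m2].
  by apply: HP; [exact: N1P|exact: N2P].
have t0_cvg (f : boolfun k) : cvg (tree_law (t0 n) R f @[n --> \oo]).
  apply: cauchy_cvg; apply: cauchy_exP => e e0.
  have [N NP] := gap_near _ _ t0_t e e0.
  exists (tree_law (t0 N) R f); exists N => // n /= Nn.
  exact: NP.
exists (fun f => lim (tree_law (t0 n) R f @[n --> \oo])); split.
  split=> [f|].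
    apply: limr_ge; first exact: t0_cvg.
    by near=> n; have [] := tree_law_distribution R k_ge1 (t0 n).
  (* The finite sum of the laws tends to the sum of the limits and is constantly 1. *)
  apply: (@cvg_unique _ _ (\sum_f tree_law (t0 n) R f @[n --> \oo])).
  - exact: Rhausdorff.
  - have FF : Filter (\oo : set_system nat) by exact: _.
    apply: (@cvg_big _ _ _ _ _ _ _ (\oo : set_system nat)).
      exact: add_continuous.
    by move=> f _; exact: t0_cvg.
  - rewrite /=; apply: cvg_near_cst; apply: nearW => n.
    by rewrite (tree_law_distribution R k_ge1 (t0 n)).2.
move=> V tn tn_t f; apply/cvgrPdist_lt => e e0.
have e2 : 0 < e / 2 by lra.
have [N NP] := gap_near _ _ tn_t _ e2.
have /cvgrPdist_lt/(_ _ e2)[M _ MP] := t0_cvg f.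
exists N => // n /= Nn; pose m := maxn N M.
have := NP n m Nn (leq_maxl _ _) f; have := MP m (leq_maxr _ _).
by move=> /= *; rewrite (le_lt_trans (ler_distD (tree_law (t0 m) R f) _ _)) //
  [X in _ + X]distrC; lra.
Unshelve. all: by end_near.
Qed.
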